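(* Let $n\ge 3$ and let $f:\mathbb{R}\to(0,\infty)$ be a smooth function. Then the Egorov space $(\mathbb{R}^n,g_f)$ is curvature-Ricci commuting and curvature-curvature commuting; that is, at every point $p$, for all tangent vectors $u,v,z,w\in T_p\mathbb{R}^n$, $$R(u,v)\cdot\widehat{\mathrm{Ric}}=\widehat{\mathrm{Ric}}\cdot R(u,v)\quad\text{and}\quad R(u,v)\cdot R(z,w)=R(z,w)\cdot R(u,v).$$
   Context: Egorov space: for $n\ge 3$ and a positive smooth function $f$ of one real variable, it is the Lorentzian manifold $(\mathbb{R}^n,g_f)$ with coordinates $(x_1,\dots,x_n)$ and metric $g_f=f(x_n)\sum_{i=1}^{n-2}(dx_i)^2+2\,dx_{n-1}dx_n$ (symmetric product, so $g_f(\partial_{n-1},\partial_n)=1$, $g_f(\partial_i,\partial_i)=f(x_n)$ for $i\le n-2$, all other components zero). Conventions: $R(X,Y)=\nabla_{[X,Y]}-[\nabla_X,\nabla_Y]$ with $\nabla$ the Levi-Civita connection, regarded as an endomorphism of the tangent space; $\mathrm{Ric}(X,Y)=\mathrm{trace}\{Z\mapsto R(X,Z)Y\}$; the Ricci operator $\widehat{\mathrm{Ric}}$ is defined by $g(\widehat{\mathrm{Ric}}X,Y)=\mathrm{Ric}(X,Y)$. The dot denotes composition of endomorphisms. *)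

(* Defs.v *)
From HB Require Import structures.
From mathcomp Require Import all_boot all_order all_algebra.
From mathcomp Require Import all_classical all_reals all_analysis.
Set Implicit Arguments.
Unset Strict Implicit.
Unset Printing Implicit Defensive.
Import Order.TTheory GRing.Theory Num.Theory.
Import numFieldNormedType.Exports.
Local Open Scope classical_set_scope.
Local Open Scope ring_scope.

(* In finite dimension, "differentiable with every
   directional derivative of class C^k" is the usual class C^(k+1). *)
Fixpoint Ck (R : realType) (V W : normedModType R) (k : nat) (F : V -> W) : Prop :=
  if k is k'.+1 then
    (forall p, differentiable F p) /\ (forall v, Ck k' ('D_v F))
  else continuous F.

Definition smooth (R : realType) (V W : normedModType R) (F : V -> W) : Prop :=
  forall k, Ck k F.

Definition vfield (R : realType) (n : nat) := 'rV[R]_n -> 'rV[R]_n.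

(* Every tangent space of R^n is identified with 'rV[R]_n through the coordinate
   frame; in these terms [X, Y]^k = X(Y^k) - Y(X^k). *)
Definition lie_bracket (R : realType) (n : nat) (X Y : vfield R n) : vfield R n :=
  fun p => 'D_(X p) Y p - 'D_(Y p) X p.

(* g p is the Gram matrix of the metric in the coordinate frame at p. *)
Definition mform (R : realType) (n : nat) (g : 'rV[R]_n -> 'M[R]_n)
    (p u v : 'rV[R]_n) : R :=
  (u *m g p *m v^T) 0 0.

(* nabla is constrained on smooth fields only, where these conditions determine it
   uniquely (Koszul) when g is symmetric and nondegenerate. *)
Record is_levi_civita (R : realType) (n : nat) (g : 'rV[R]_n -> 'M[R]_n)
    (nabla : vfield R n -> vfield R n -> vfield R n) : Prop := IsLeviCivita {
  lc_smooth : forall X Y, smooth X -> smooth Y -> smooth (nabla X Y);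
  lc_addl : forall X X' Y, smooth X -> smooth X' -> smooth Y ->
    forall p, nabla (fun q => X q + X' q) Y p = nabla X Y p + nabla X' Y p;
  lc_scalel : forall (h : 'rV[R]_n -> R) X Y, smooth h -> smooth X -> smooth Y ->
    forall p, nabla (fun q => h q *: X q) Y p = h p *: nabla X Y p;
  lc_addr : forall X Y Y', smooth X -> smooth Y -> smooth Y' ->
    forall p, nabla X (fun q => Y q + Y' q) p = nabla X Y p + nabla X Y' p;
  lc_leibniz : forall (h : 'rV[R]_n -> R) X Y, smooth h -> smooth X -> smooth Y ->
    forall p, nabla X (fun q => h q *: Y q) p =
              'D_(X p) h p *: Y p + h p *: nabla X Y p;
  lc_torsion_free : forall X Y, smooth X -> smooth Y ->
    forall p, nabla X Y p - nabla Y X p = lie_bracket X Y p;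
  lc_metric : forall X Y Z, smooth X -> smooth Y -> smooth Z ->
    forall p, 'D_(X p) (fun q => mform g q (Y q) (Z q)) p =
              mform g p (nabla X Y p) (Z p) + mform g p (Y p) (nabla X Z p)
}.

(* Sign convention: R(X, Y) = nabla_[X, Y] - [nabla_X, nabla_Y]. *)
Definition curvature (R : realType) (n : nat)
    (nabla : vfield R n -> vfield R n -> vfield R n) (X Y Z : vfield R n) :
    vfield R n :=
  fun p => nabla (lie_bracket X Y) Z p -
           (nabla X (nabla Y Z) p - nabla Y (nabla X Z) p).

(* The curvature is tensorial, so any smooth extensions of the tangent vectors
   u, v, w at p give the same value; the constant ones are used here. *)
Definition curvature_at (R : realType) (n : nat)
    (nabla : vfield R n -> vfield R n -> vfield R n)
    (p u v : 'rV[R]_n) : 'rV[R]_n -> 'rV[R]_n :=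
  fun w => curvature nabla (cst u) (cst v) (cst w) p.

(* Ric(x, y) = trace (z |-> R(x, z) y). *)
Definition ricci (R : realType) (n : nat)
    (nabla : vfield R n -> vfield R n -> vfield R n) (p x y : 'rV[R]_n) : R :=
  \tr (lin1_mx (fun z => curvature_at nabla p x z y)).

(* The operator Q with g(Q x, y) = Ric(x, y), unique as g p is nondegenerate. *)
Definition ricci_operator (R : realType) (n : nat) (g : 'rV[R]_n -> 'M[R]_n)
    (nabla : vfield R n -> vfield R n -> vfield R n) (p : 'rV[R]_n) :
    'rV[R]_n -> 'rV[R]_n :=
  get [set Q : 'rV[R]_n -> 'rV[R]_n |
       forall x y, mform g p (Q x) y = ricci nabla p x y].

Definition curvature_ricci_commuting (R : realType) (n : nat)
    (g : 'rV[R]_n -> 'M[R]_n)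
    (nabla : vfield R n -> vfield R n -> vfield R n) : Prop :=
  forall p u v : 'rV[R]_n,
    curvature_at nabla p u v \o ricci_operator g nabla p =
    ricci_operator g nabla p \o curvature_at nabla p u v.

Definition curvature_curvature_commuting (R : realType) (n : nat)
    (nabla : vfield R n -> vfield R n -> vfield R n) : Prop :=
  forall p u v z w : 'rV[R]_n,
    curvature_at nabla p u v \o curvature_at nabla p z w =
    curvature_at nabla p z w \o curvature_at nabla p u v.

Lemma last_coord_proof (n : nat) : (3 <= n)%N -> (n.-1 < n)%N.
Proof. by case: n. Qed.

(* The coordinates x_1, ..., x_n are indexed by 'I_n from 0, so x_n is the
   coordinate n.-1, and x_i has i <= n-2 exactly when its index k has k.+2 < n. *)
Definition egorov_metric (R : realType) (n : nat) (hn : (3 <= n)%N) (f : R -> R) :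
    'rV[R]_n -> 'M[R]_n :=
  fun x => \matrix_(i, j)
    if (i == j) && (i.+2 < n)%N then f (x 0 (Ordinal (last_coord_proof hn)))
    else if ((i.+2 == n) && (j.+1 == n)) || ((i.+1 == n) && (j.+2 == n)) then 1
    else 0.

(* Main.v *)
(* Write P for the projection onto the first n - 2 coordinates, <v, w> for the
   Euclidean product of P v and P w, N for the null field d_(n-1), and F for f(x_n).
   On constant fields the Koszul formula gives
     nabla_u v = alpha (u_n P v + v_n P u) - beta <u, v> N,
   with alpha = F' / 2F and beta = F' / 2 depending on x_n only. Differentiating
   once more, and putting s = u_n P v - v_n P u,
     R(u, v) w = (beta' - alpha beta) <s, w> N - (alpha' + alpha^2) w_n s.
   Hence R(u, v) takes values in {x_n = 0} and kills N, and
   R(u, v) R(z, w) y is y_n <s, s'> N up to a factor independent of the order of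
   the two operators. The Ricci operator is x |-> k x_n N, so its products with
   R(u, v) on both sides vanish. *)
Require Import Defs.
From HB Require Import structures.
From mathcomp Require Import all_boot all_order all_algebra.
From mathcomp Require Import all_classical all_reals all_analysis.
From mathcomp Require Import zify ring lra.
Import Order.TTheory GRing.Theory Num.Theory.
Import numFieldNormedType.Exports.
Local Open Scope classical_set_scope.
Local Open Scope ring_scope.
Set Implicit Arguments.
Unset Strict Implicit.

(** * Smooth maps between normed spaces *)

Section Smooth.
Variable R : realType.

Lemma derive_linear_comp (U V W : normedModType R) (L : {linear V -> W}) (F : U -> V) :
  continuous L -> (forall p, differentiable F p) ->
  forall v, 'D_v (L \o F) = L \o 'D_v F.
Proof.
move=> cL dF v; apply/funext => p.
have dL x : differentiable L x by exact: linear_differentiable.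
rewrite /= !deriveE //; last exact: differentiable_comp.
by rewrite diff_comp ?diff_lin.
Qed.

(** Directional derivatives commute with [L], so the class C^k passes through by induction on
    [k]. *)
Lemma smooth_linear_comp (U V W : normedModType R) (L : {linear V -> W}) (F : U -> V) :
  continuous L -> smooth F -> smooth (L \o F).
Proof.
move=> cL sF k; elim: k F {sF}(sF k) => [|k IH] F /=.
  by move=> cF x; apply: continuous_comp; [exact: cF | exact: cL].
move=> [dF DF]; split=> [p|v].
  by apply: differentiable_comp => //; exact: linear_differentiable.
by rewrite derive_linear_comp //; apply/IH/DF.
Qed.

Lemma smooth_cst (U V : normedModType R) (c : V) : smooth (cst c : U -> V).
Proof.
move=> k; elim: k c => [|k IH] c /=; first by move=> x; exact: cvg_cst.
split=> [p|v]; first exact: differentiable_cst.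
rewrite (_ : 'D_v _ = cst 0) //; by apply/funext => p; rewrite derive_cst.
Qed.

Lemma smooth_differentiable (U V : normedModType R) (F : U -> V) p :
  smooth F -> differentiable F p.
Proof. by move=> /(_ 1) [dF _]; exact: dF. Qed.

Lemma smooth_scalel (U V : normedModType R) (h : U -> R) (x : V) :
  smooth h -> smooth (fun p => h p *: x).
Proof.
have sx_lin : linear ( *:%R ^~ x : R -> V).
  by move=> u y z; rewrite scalerDl scalerA.
pose sxlM := GRing.isLinear.Build _ _ _ _ _ sx_lin.
pose sxL : {linear R -> V} := HB.pack ( *:%R ^~ x) sxlM.
by apply: (smooth_linear_comp (L := sxL)); exact: scalel_continuous.
Qed.

Lemma smooth_coord (U : normedModType R) n (X : U -> 'rV[R]_n) i :
  smooth X -> smooth (fun p => X p 0 i).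
Proof.
have coord_lin : linear (fun x : 'rV[R]_n => x 0 i : R) by move=> a x y; rewrite !mxE.
pose coordM := GRing.isLinear.Build _ _ _ _ _ coord_lin.
pose L : {linear 'rV[R]_n -> R} := HB.pack (fun x : 'rV[R]_n => x 0 i) coordM.
by apply: (smooth_linear_comp (L := L)); exact: coord_continuous.
Qed.

End Smooth.

(** * Functions of a single coordinate *)

Section OneCoord.
Variables (R : realType) (n : nat) (i : 'I_n).

Definition depends_on_coord (H : 'rV[R]_n -> R) : Prop :=
  forall x y : 'rV[R]_n, x 0 i = y 0 i -> H x = H y.

(** The difference quotients coincide, hence so do their limits, with no differentiability
    involved. *)
Lemma eq_derive (H G : 'rV[R]_n -> R) v x y :
  (forall h : R, H (h *: v + x) - H x = G (h *: v + y) - G y) ->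
  'D_v H x = 'D_v G y.
Proof.
move=> HG; rewrite /derive.
rewrite (_ : (fun _ => _) = (fun h => h^-1 *: ((G \o shift y) (h *: v) - G y))) //.
by apply/funext => h /=; rewrite HG.
Qed.

Lemma depends_on_coord_derive (H : 'rV[R]_n -> R) v :
  depends_on_coord H -> depends_on_coord ('D_v H).
Proof.
move=> Hi x y xy; apply: eq_derive => h.
by congr (_ - _); apply: Hi; rewrite // !mxE xy.
Qed.

(** Split [u] into a vector with zero [i]-th coordinate, along which [H] is constant, and a multiple
    of [e]; differentiability makes the derivative additive in the direction. *)
Lemma derive_depends_on_coord (H : 'rV[R]_n -> R) (p u : 'rV[R]_n) :
  depends_on_coord H -> differentiable H p ->
  'D_u H p = u 0 i * 'D_(delta_mx 0 i) H p.
Proof.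
move=> Hi dH; set e := delta_mx 0 i.
have H0 (v : 'rV[R]_n) : v 0 i = 0 -> 'D_v H p = 0.
  move=> vi; rewrite -(derive_cst (H p) p v); apply: eq_derive => h.
  by congr (_ - _); apply: Hi; rewrite !mxE vi mulr0 add0r.
have {1}-> : u = (u - u 0 i *: e) + u 0 i *: e by rewrite subrK.
rewrite !deriveE // linearD [in X in _ + X]linearZ /= -!deriveE //.
by rewrite H0 ?add0r // !mxE !eqxx mulr1 subrr.
Qed.

End OneCoord.

(** * Coordinates and the metric form *)

Section Egorov.
Variables (R : realType) (n : nat) (hn : (3 <= n)%N) (f : R -> R).

Local Notation g := (egorov_metric hn f).
Local Notation last := (Ordinal (last_coord_proof hn)).

Lemma penult_coord_proof : (n.-2 < n)%N.
Proof. by case: n hn => [|[|]]. Qed.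

Local Notation penult := (Ordinal penult_coord_proof).

Definition transverse (v : 'rV[R]_n) : 'rV[R]_n :=
  \row_i (if (i.+2 < n)%N then v 0 i else 0).

Definition tdot (v w : 'rV[R]_n) : R := \sum_(i < n | (i.+2 < n)%N) v 0 i * w 0 i.

Definition null : 'rV[R]_n := delta_mx 0 penult.

Lemma last_trans : (last.+2 < n)%N = false.
Proof. by apply/negbTE; rewrite -leqNgt /=; lia. Qed.

Lemma penult_trans : (penult.+2 < n)%N = false.
Proof. by apply/negbTE; rewrite -leqNgt /=; lia. Qed.

Lemma coordP (i : 'I_n) : [\/ (i.+2 < n)%N, i = penult | i = last].
Proof.
have [h|h] := ltnP i.+2 n; first by constructor 1.
have [e|ne] := eqVneq (i : nat) n.-1.
  by constructor 3; apply/val_inj.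
constructor 2; apply/val_inj => /=; have := ltn_ord i; lia.
Qed.

Lemma penult_neq_last : penult != last.
Proof. by rewrite -val_eqE /=; apply/eqP; lia. Qed.

Lemma trans_neq_penult (i : 'I_n) : (i.+2 < n)%N -> i != penult.
Proof. by move=> h; apply/eqP => e; move: h; rewrite e penult_trans. Qed.

Lemma trans_neq_last (i : 'I_n) : (i.+2 < n)%N -> i != last.
Proof. by move=> h; apply/eqP => e; move: h; rewrite e last_trans. Qed.

Lemma sum_coord (F : 'I_n -> R) :
  \sum_i F i = \sum_(i < n | (i.+2 < n)%N) F i + F penult + F last.
Proof.
rewrite (bigID (fun i : 'I_n => (i.+2 < n)%N)) /= -addrA; congr (_ + _).
rewrite (bigD1 penult) ?penult_trans //= (bigD1 last) /=; last first.
  by rewrite last_trans eq_sym penult_neq_last.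
rewrite big1 ?addr0 // => i /andP[/andP[hi /eqP ip] /eqP il].
by case: (coordP i) => // h; rewrite h in hi.
Qed.

Lemma mformE (p v w : 'rV[R]_n) : mform g p v w =
  f (p 0 last) * tdot v w + v 0 last * w 0 penult + v 0 penult * w 0 last.
Proof.
(* Each column [j] of the Gram matrix has a single nonzero row [s]: it is [j] itself for transverse
   [j], while [penult] and [last] are exchanged. *)
have row (j s : 'I_n) : (forall i, i != s -> g p i j = 0) ->
    (v *m g p) 0 j = v 0 s * g p s j.
  move=> h; rewrite mxE (bigD1 s) //= big1 ?addr0 // => i /h ->.
  by rewrite mulr0.
rewrite /mform mxE sum_coord; congr (_ + _ + _).
- rewrite /tdot mulr_sumr; apply: eq_bigr => j hj.
  rewrite (row j j) ?mxE ?eqxx ?hj /=; first by ring.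
  move=> i /negbTE ij; rewrite mxE ij /=; case: ifP => //.
  by case/orP => /andP[/eqP h1 /eqP h2]; lia.
- rewrite (row _ last) ?mxE /=; last first.
    move=> i /eqP il; rewrite mxE; case: ifP => [/andP[/eqP ->]|_].
      by rewrite penult_trans.
    case: ifP => //= /orP[] /andP[/eqP h1 /eqP h2]; first by lia.
    by case: il; apply/val_inj => /=; lia.
  rewrite ifF ?ifT ?mulr1 //; first by apply/orP; right; lia.
  by rewrite -val_eqE /=; lia.
- rewrite (row _ penult) ?mxE /=; last first.
    move=> i /eqP il; rewrite mxE; case: ifP => [/andP[/eqP ->]|_].
      by rewrite last_trans.
    case: ifP => //= /orP[] /andP[/eqP h1 /eqP h2]; last by lia.
    by case: il; apply/val_inj => /=; lia.
  rewrite ifF ?ifT ?mulr1 //; first by apply/orP; left; lia.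
  by rewrite -val_eqE /=; lia.
Qed.

Lemma mform_delta_trans (p v : 'rV[R]_n) (i : 'I_n) : (i.+2 < n)%N ->
  mform g p v (delta_mx 0 i) = f (p 0 last) * v 0 i.
Proof.
move=> hi; rewrite mformE /tdot (bigD1 i) //= big1 => [|j /andP[_ /negbTE ji]].
  rewrite !mxE !eqxx !(eq_sym _ i).
  by rewrite (negbTE (trans_neq_penult hi)) (negbTE (trans_neq_last hi)) /=; ring.
by rewrite mxE ji andbF mulr0.
Qed.

Lemma mform_delta_penult (p v : 'rV[R]_n) : mform g p v null = v 0 last.
Proof.
rewrite mformE /tdot big1 => [|j hj]; rewrite !mxE ?eqxx; last first.
  by rewrite (negbTE (trans_neq_penult hj)) mulr0.
by rewrite eq_sym (negbTE penult_neq_last) /=; ring.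
Qed.

Lemma mform_delta_last (p v : 'rV[R]_n) :
  mform g p v (delta_mx 0 last) = v 0 penult.
Proof.
rewrite mformE /tdot big1 => [|j hj]; rewrite !mxE ?eqxx; last first.
  by rewrite (negbTE (trans_neq_last hj)) mulr0.
by rewrite (negbTE penult_neq_last) /=; ring.
Qed.

Lemma tdotC v w : tdot v w = tdot w v.
Proof. by apply: eq_bigr => i _; rewrite mulrC. Qed.

Lemma tdotDl u v w : tdot (u + v) w = tdot u w + tdot v w.
Proof. by rewrite -big_split; apply: eq_bigr => i _; rewrite mxE mulrDl. Qed.

Lemma tdotZl (c : R) v w : tdot (c *: v) w = c * tdot v w.
Proof. by rewrite mulr_sumr; apply: eq_bigr => i _; rewrite mxE mulrA. Qed.

Lemma tdotBl u v w : tdot (u - v) w = tdot u w - tdot v w.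
Proof. by rewrite tdotDl -scaleN1r tdotZl mulN1r. Qed.

Lemma tdot_transverse v w : tdot (transverse v) w = tdot v w.
Proof. by apply: eq_bigr => i hi; rewrite mxE hi. Qed.

Lemma tdot_null v : tdot null v = 0.
Proof.
rewrite /tdot big1 // => j hj.
by rewrite mxE (negbTE (trans_neq_penult hj)) mul0r.
Qed.

Lemma null_last : null 0 last = 0.
Proof. by rewrite mxE eq_sym (negbTE penult_neq_last). Qed.

Lemma transverseD u v : transverse (u + v) = transverse u + transverse v.
Proof. by apply/rowP => i; rewrite !mxE; case: ifP; rewrite ?addr0. Qed.

Lemma transverseZ (c : R) v : transverse (c *: v) = c *: transverse v.
Proof. by apply/rowP => i; rewrite !mxE; case: ifP; rewrite ?mulr0. Qed.

Lemma transverse_id v : transverse (transverse v) = transverse v.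
Proof. by apply/rowP => i; rewrite !mxE; case: (_ < n)%N. Qed.

Lemma transverse_null : transverse null = 0.
Proof.
by apply/rowP => i; rewrite !mxE; case: ifP => // /trans_neq_penult /negbTE ->.
Qed.

Hypothesis f_smooth : smooth f.
Hypothesis f_gt0 : forall t, 0 < f t.

(** Nondegeneracy: pairing with the coordinate vectors recovers every coordinate, up to the positive
    factor [f] for the transverse ones. *)
Lemma mform_inj (p x y : 'rV[R]_n) :
  (forall w, mform g p x w = mform g p y w) -> x = y.
Proof.
move=> xy; apply/rowP => i; case: (coordP i) => [hi|->|->].
- have := xy (delta_mx 0 i); rewrite !mform_delta_trans // => /mulfI; apply.
  by rewrite gt_eqF.
- by rewrite -!(mform_delta_last p) xy.
- by rewrite -!(mform_delta_penult p) xy.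
Qed.

(** * The warping function and its derivative *)

Definition warp (q : 'rV[R]_n) : R := f (q 0 last).

(** This is f'(x_n), taken as a directional derivative on R^n so that the one-coordinate lemmas
    apply to it. *)
Definition dwarp : 'rV[R]_n -> R := 'D_(delta_mx 0 last) warp.

Lemma warp_coord : depends_on_coord last warp.
Proof. by move=> x y; rewrite /warp => ->. Qed.

Lemma warp_diff p : differentiable warp p.
Proof.
apply: (@differentiable_comp _ _ _ _ (fun q : 'rV[R]_n => q 0 last) f).
  exact: differentiable_coord.
exact: smooth_differentiable.
Qed.

Lemma derive_mform (p u v w : 'rV[R]_n) :
  'D_u (fun q => mform g q v w) p = u 0 last * dwarp p * tdot v w.
Proof.
rewrite (_ : (fun _ => _) = (tdot v w \*: warp) +
  cst (v 0 last * w 0 penult + v 0 penult * w 0 last)); last first.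
  by apply/funext => q; rewrite mformE /= addrA mulrC.
have dw : derivable warp p u by apply/diff_derivable/warp_diff.
rewrite deriveD //; last exact: derivableZ.
rewrite deriveZ // derive_cst addr0 (derive_depends_on_coord _ warp_coord) //.
  exact: mulrC.
exact: warp_diff.
Qed.

(** * The connection on constant fields *)

Variable nabla : vfield R n -> vfield R n -> vfield R n.
Hypothesis nabla_lc : is_levi_civita g nabla.

(** Constant fields have zero bracket, so [nabla] is symmetric on them, and the three cyclic
    instances of metric compatibility combine linearly. *)
Lemma koszul_cst p u v w :
  2 * mform g p (nabla (cst u) (cst v) p) w =
  dwarp p * (u 0 last * tdot v w + v 0 last * tdot u w - w 0 last * tdot u v).
Proof.
have sm x : smooth (cst x : vfield R n) by exact: smooth_cst.
have mC x y : mform g p x y = mform g p y x.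
  by rewrite !mformE tdotC; ring.
have tf x y : nabla (cst x) (cst y) p = nabla (cst y) (cst x) p.
  apply/eqP; rewrite -subr_eq0 (lc_torsion_free nabla_lc) //.
  by rewrite /lie_bracket !derive_cst subrr.
have M x y z := lc_metric nabla_lc (sm x) (sm y) (sm z) p.
have := M u v w; have := M v u w; have := M w u v.
rewrite !derive_mform (mC _ (nabla _ (cst w) p)) (mC _ (nabla _ (cst w) p)).
rewrite (mC _ (nabla _ (cst v) p)) /= (tf w u) (tf w v) (tf v u).
rewrite /cst /=; lra.
Qed.

Definition alpha (q : 'rV[R]_n) : R := dwarp q / (2 * warp q).
Definition beta (q : 'rV[R]_n) : R := dwarp q / 2.

Lemma dwarp_coord : depends_on_coord last dwarp.
Proof. exact/depends_on_coord_derive/warp_coord. Qed.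

Lemma alpha_coord : depends_on_coord last alpha.
Proof.
by move=> x y xy; rewrite /alpha (warp_coord xy) (dwarp_coord xy).
Qed.

Lemma beta_coord : depends_on_coord last beta.
Proof.
by move=> x y xy; rewrite /beta (dwarp_coord xy).
Qed.

Definition tsym (u v : 'rV[R]_n) : 'rV[R]_n :=
  u 0 last *: transverse v + v 0 last *: transverse u.

(** Each summand is kept as a function times a constant field, the shape to which the Leibniz rule
    applies in a second differentiation. *)
Lemma nabla_cst u v : nabla (cst u) (cst v) =
  fun q => alpha q *: tsym u v + beta q *: (- tdot u v *: null).
Proof.
apply/funext => p; apply: (@mform_inj p) => w; apply: (@mulfI _ 2).
  by rewrite pnatr_eq0.
rewrite koszul_cst !mformE !(tdotDl, tdotZl) tdot_null !tdot_transverse.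
have w0 : f (p 0 last) != 0 by rewrite gt_eqF.
rewrite !mxE last_trans penult_trans !eqxx (eq_sym last) (negbTE penult_neq_last) /=.
by rewrite /alpha /beta /warp; field.
Qed.

(* Smoothness of alpha and beta comes for free: both are coordinates of a
   covariant derivative of constant fields, which is smooth by hypothesis. *)
Lemma smooth_alpha : smooth alpha.
Proof.
have n0 : (0 < n)%N by apply: leq_trans hn.
pose i : 'I_n := Ordinal n0.
have sN : smooth (nabla (cst (delta_mx 0 last)) (cst (delta_mx 0 i))).
  by apply: (lc_smooth nabla_lc); exact: smooth_cst.
move: (smooth_coord i sN); rewrite nabla_cst.
rewrite (_ : (fun _ => _) = alpha) //; apply/funext => q.
(* For index 0 this unfolds to [3 <= n], so a transverse direction exists. *)
have hi : (i.+2 < n)%N by [].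
rewrite !mxE hi !eqxx /= (negbTE (trans_neq_penult hi)) (negbTE (trans_neq_last hi)).
by rewrite eq_sym (negbTE (trans_neq_last hi)) /=; ring.
Qed.

Lemma smooth_beta : smooth beta.
Proof.
have n0 : (0 < n)%N by apply: leq_trans hn.
pose i : 'I_n := Ordinal n0; pose e : 'rV[R]_n := delta_mx 0 i.
(* The sign of [- e] cancels the one in front of [tdot], so that the [penult] coordinate is exactly
   [beta]. *)
have sN : smooth (nabla (cst e) (cst (- e))).
  by apply: (lc_smooth nabla_lc); exact: smooth_cst.
move: (smooth_coord penult sN); rewrite nabla_cst.
rewrite (_ : (fun _ => _) = beta) //; apply/funext => q.
have hi : (i.+2 < n)%N by [].
rewrite tdotC -scaleN1r tdotZl /tdot (bigD1 i) //= big1 => [|j /andP[_ /negbTE ji]].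
  rewrite !mxE penult_trans !eqxx /=; ring.
by rewrite mxE ji andbF mul0r.
Qed.

(** The Leibniz rule differentiates [alpha] and [beta], functions of x_n alone, whence the factors
    [u 0 last]; the other terms come from [nabla_cst] again. *)
Lemma nabla_nabla_cst p u v w :
  nabla (cst u) (nabla (cst v) (cst w)) p =
  (u 0 last * ('D_(delta_mx 0 last) alpha p + alpha p ^+ 2)) *: tsym v w
  - (alpha p * beta p * tdot u (tsym v w)
     + u 0 last * 'D_(delta_mx 0 last) beta p * tdot v w) *: null.
Proof.
have sm x : smooth (cst x : vfield R n) by exact: smooth_cst.
have sa := smooth_alpha; have sb := smooth_beta.
rewrite [nabla (cst v) _]nabla_cst.
rewrite (lc_addr nabla_lc) //; try exact: smooth_scalel.
rewrite (lc_leibniz nabla_lc (Y := cst (tsym v w))) //.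
rewrite (lc_leibniz nabla_lc (Y := cst (- tdot v w *: null))) //.
rewrite !nabla_cst /=.
rewrite (derive_depends_on_coord _ alpha_coord); last exact: smooth_differentiable.
rewrite (derive_depends_on_coord _ beta_coord); last exact: smooth_differentiable.
set x := tsym v w.
(* Since [x] is purely transverse, [tsym u x] is just [u 0 last *: x]. *)
have xl : x 0 last = 0 by rewrite !mxE last_trans !mulr0 addr0.
have tx : transverse x = x by rewrite transverseD !transverseZ !transverse_id.
rewrite [tdot u (- _ *: _)]tdotC tdotZl tdot_null.
rewrite /tsym xl tx transverseZ transverse_null [(_ *: null) 0 last]mxE null_last.
by apply/rowP => i; rewrite !mxE /=; ring.
Qed.

(** * The curvature operators *)

Definition wedge (u v : 'rV[R]_n) : 'rV[R]_n :=
  u 0 last *: transverse v - v 0 last *: transverse u.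

Definition curv_trans (p : 'rV[R]_n) : R :=
  'D_(delta_mx 0 last) alpha p + alpha p ^+ 2.
Definition curv_null (p : 'rV[R]_n) : R :=
  'D_(delta_mx 0 last) beta p - alpha p * beta p.

(** Antisymmetrizing [nabla_nabla_cst] in [u] and [v] cancels the terms in [u 0 last * v 0 last] and
    in [tdot u v]; the rest assembles into [wedge u v]. *)
Lemma curvature_atE p u v w : curvature_at nabla p u v w =
  (curv_null p * tdot (wedge u v) w) *: null
  - (curv_trans p * w 0 last) *: wedge u v.
Proof.
have sm x : smooth (cst x : vfield R n) by exact: smooth_cst.
rewrite /curvature_at /curvature.
(* The zero bracket is written as the zero function times a field, so that [lc_scalel] makes its
   term vanish. *)
rewrite (_ : lie_bracket _ _ = fun q => cst 0 q *: cst u q); last first.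
  by apply/funext => q; rewrite /lie_bracket !derive_cst subrr scale0r.
rewrite (lc_scalel nabla_lc) ?scale0r ?sub0r //; last exact: smooth_cst.
rewrite !nabla_nabla_cst /curv_null /curv_trans /tsym /wedge.
rewrite tdotBl !(tdotC _ (_ + _)) !tdotDl !tdotZl !tdot_transverse.
rewrite (tdotC v u) !(tdotC w).
by apply/rowP => i; rewrite !mxE; ring.
Qed.

Lemma curvature_at_null p u v (c : R) : curvature_at nabla p u v (c *: null) = 0.
Proof.
rewrite curvature_atE tdotC tdotZl tdot_null mxE null_last.
by rewrite !mulr0 !scale0r subrr.
Qed.

Lemma curvature_at_last p u v w : curvature_at nabla p u v w 0 last = 0.
Proof.
by rewrite curvature_atE 2!mxE null_last mulr0 add0r !mxE last_trans; ring.
Qed.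

Lemma curvature_at_comp p u v z w y :
  curvature_at nabla p u v (curvature_at nabla p z w y) =
  (- curv_null p * curv_trans p * y 0 last * tdot (wedge u v) (wedge z w)) *: null.
Proof.
(* The inner value has zero last coordinate, so only the [null] term of the outer operator
   survives. *)
rewrite [LHS]curvature_atE curvature_at_last mulr0 scale0r subr0.
rewrite [curvature_at _ _ _ _ _]curvature_atE tdotC tdotBl !tdotZl tdot_null.
by rewrite (tdotC (wedge u v)); congr (_ *: _); ring.
Qed.

(** Gives the [penult] diagonal entry of the trace defining [ricci]. *)
Lemma curvature_at_nulll p u w : curvature_at nabla p u null w = 0.
Proof.
rewrite curvature_atE.
have -> : wedge u null = 0.
  by rewrite /wedge transverse_null null_last scaler0 scale0r subrr.
by rewrite -(scale0r null) tdotZl mul0r mulr0 !scale0r scaler0 subrr.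
Qed.

(** * The Ricci tensor and the Ricci operator *)

Lemma ricciE p : exists k : R, forall x y,
  ricci nabla p x y = k * x 0 last * y 0 last.
Proof.
(* Each of the n - 2 transverse directions contributes [- curv_trans p] to the trace; [penult] and
   [last] contribute 0. *)
exists (\sum_(i < n | (i.+2 < n)%N) - curv_trans p) => x y.
rewrite /ricci /mxtrace sum_coord !big_distrl /=.
rewrite [X in _ + X + _]mxE [X in _ + X]mxE curvature_at_last addr0.
rewrite -/null curvature_at_nulll mxE addr0; apply: eq_bigr => i hi.
rewrite mxE curvature_atE !mxE hi (negbTE (trans_neq_penult hi)) !eqxx /=.
by rewrite (eq_sym last) (negbTE (trans_neq_last hi)) /=; ring.
Qed.

Lemma mform_nulll (p w : 'rV[R]_n) (c : R) : mform g p (c *: null) w = c * w 0 last.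
Proof.
rewrite mformE tdotZl tdot_null !mxE !eqxx eq_sym (negbTE penult_neq_last) /=.
by ring.
Qed.

Lemma ricci_operatorE p : exists k : R, forall x,
  ricci_operator g nabla p x = (k * x 0 last) *: null.
Proof.
have [k ric] := ricciE p; exists k => x.
have Q : forall x y, mform g p (ricci_operator g nabla p x) y = ricci nabla p x y.
  (* [get] satisfies its specification only once a solution is exhibited; [mform_inj] then
     identifies the chosen operator with that solution. *)
  rewrite /ricci_operator; apply: (@getPex _
    [set Q | forall x y, mform g p (Q x) y = ricci nabla p x y]).
  exists (fun x => (k * x 0 last) *: null) => a b.
  by rewrite ric mform_nulll.
by apply: (@mform_inj p) => w; rewrite Q ric mform_nulll.
Qed.

End Egorov.

Theorem theorem6 (R : realType) (n : nat) (hn : (3 <= n)%N) (f : R -> R)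
    (f_smooth : smooth f) (f_gt0 : forall t, 0 < f t)
    (nabla : vfield R n -> vfield R n -> vfield R n)
    (nabla_lc : is_levi_civita (egorov_metric hn f) nabla) :
  curvature_ricci_commuting (egorov_metric hn f) nabla /\
  curvature_curvature_commuting nabla.
Proof.
split=> [p u v | p u v z w]; apply/funext => y /=.
  have [k ric] := ricci_operatorE f_smooth f_gt0 nabla_lc p.
  rewrite !ric (curvature_at_null f_smooth f_gt0 nabla_lc).
  by rewrite (curvature_at_last f_smooth f_gt0 nabla_lc) mulr0 scale0r.
by rewrite !(curvature_at_comp f_smooth f_gt0 nabla_lc) (tdotC (wedge hn u v)).
Qed.
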